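(* Let $p$ be a prime and let $J$ be a Young diagram with $N(J)=p-1$. Then $$d(J)\equiv 1\pmod p.$$
   Context: A Young diagram is a finite (possibly empty) sequence $J=(j_1,\dots,j_m)$ of integers with $j_1\ge\dots\ge j_m>0$. Put $N(J)=j_1+\dots+j_m$ and $n_k(J)=\#\{s\mid j_s=k\}$. The integer-valued function $d$ on Young diagrams is defined recursively: $d(\emptyset)=1$, and for a nonempty $J=(j_1,\dots,j_m)$ with $N(J)=N$, $$d(J)=\sum_{s:\,j_s>j_{s+1}}(N-j_s+1)\,n_{j_s}(J)\,d(j_1,\dots,j_{s-1},j_s-1,j_{s+1},\dots,j_m),$$ where the sum is over $1\le s\le m$ with $j_s>j_{s+1}$, with the convention $j_{m+1}=0$; if $s=m$ and $j_s=1$, the resulting zero entry $j_s-1=0$ is deleted from the sequence. For example, $d(1)=1$, $d(1,1)=4$, $d(2)=1$, $d(2,1)=11$. *)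

(* Defs.v *)
From mathcomp Require Import all_boot.

Set Implicit Arguments.
Unset Strict Implicit.
Unset Printing Implicit Defensive.

Definition young_diagram (J : seq nat) : bool :=
  sorted geq J && all (ltn 0) J.

(* Parts are numbered from 0; the default 0 of nth gives the convention
   j_(m+1) = 0 for the entry after the last one. *)
Definition part (J : seq nat) (s : nat) : nat := nth 0 J s.

(* On a Young diagram with part J s.+1 < part J s, at most one entry of the
   decreased sequence is 0, namely the last one. *)
Definition remove_box (J : seq nat) (s : nat) : seq nat :=
  [seq j <- set_nth 0 J s (part J s).-1 | 0 < j].

(* The argument N is meant to be sumn J, which drops by 1 at each recursive
   call. The subtraction is never truncated, since part J s <= sumn J. *)
Fixpoint d_rec (N : nat) (J : seq nat) : nat :=
  if N is N'.+1 then
    \sum_(s < size J | part J s.+1 < part J s)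
      (N - part J s + 1) * count_mem (part J s) J * d_rec N' (remove_box J s)
  else 1.

Definition d (J : seq nat) : nat := d_rec (sumn J) J.

Lemma sumn_remove_box (J : seq nat) (s : nat) :
  0 < part J s -> sumn (remove_box J s) = (sumn J).-1.
Proof.
have sumn_pos (t : seq nat) : sumn [seq j <- t | 0 < j] = sumn t.
  by elim: t => [|[|x] t IHt] //=; rewrite IHt.
rewrite /remove_box sumn_pos /part.
elim: J s => [|x J IHJ] [|s] //= Js; first by case: x Js.
rewrite IHJ //; suff: 0 < sumn J by case: (sumn J) => // n _; rewrite addnS.
by elim: J s Js {IHJ} => [|y J IHJ] [|s] //= Js;
  rewrite addn_gt0 ?Js // (IHJ s) ?orbT.
Qed.

Lemma d_nil : d [::] = 1.
Proof. by []. Qed.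

Lemma dE (J : seq nat) : young_diagram J -> J != [::] ->
  d J = \sum_(s < size J | part J s.+1 < part J s)
          (sumn J - part J s + 1) * count_mem (part J s) J
            * d (remove_box J s).
Proof.
move=> /andP[_ posJ] J_nnil.
have: 0 < sumn J.
  by case: J posJ J_nnil => //= x J /andP[x_gt0 _] _; rewrite addn_gt0 x_gt0.
rewrite {1}/d; case EN: (sumn J) => [|N] //= _.
apply: eq_bigr => s lt_s; rewrite /d sumn_remove_box ?EN //.
exact: leq_ltn_trans lt_s.
Qed.

(* Main.v *)
From HB Require Import structures.
Require Import Defs.
From mathcomp Require Import all_boot all_order all_algebra.
From mathcomp Require Import mpoly zify ring.

(** The recursion removes a box, and after regrouping equal parts it removes
one from a single part [x] of the multiset of parts, with weight [N - x + 1],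
[N] being the current sum. Read backwards, this builds a word with [j_s]
letters [s]: a new letter [s] gets as weight one plus the number of earlier
letters different from [s]. So [d J] is the sum, over the words with content
[J], of the products of these weights.

The same sum arises by iterating a derivation. Let [x_s] be one variable for
each part, [f = prod_s (1 + x_s z)] and [D = f d/dz]. If a word [w] of length
[n] has [c_r] letters [r], attach to it the polynomial
[T_w = (prod_(s in w) x_s) prod_r (1 + x_r z)^(n + 1 - c_r)]. Then
[D T_w = sum_s (n - c_s + 1) T_(sw)] and [T] of the empty word is [f], whence
[D^n f] is the weighted sum of the [T_w] over the words of length [n]
([scaled_derivn_words]). At [z = 0], the coefficient of [x^J] in [D^N f] is
[d J] ([mcoeff_scaled_derivn]).

Now let [N = p - 1] and work in characteristic [p], where [D^p] is again a
derivation. The value at 0 of [D^(p-1) (f z^k)] is then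
- 0 for [0 < k < p - 1], since [(k + 1) f z^k = D (z^(k+1))] and the derivation
  [D^p] maps the multiple [z^(k+1)] of [z^2] to a multiple of [z];
- [(p - 1)! = -1] for [k = p - 1], and 0 for [k >= p], because each [D] lowers
  the order of vanishing at 0 by at most one.
Hence if [v = sum_k v_k z^k] with [v_0 = 1] makes [f v] a polynomial with zero
derivative, applying [D^(p-1)] to [f v] gives [0 = (D^(p-1) f)(0) - v_(p-1)]
([coef0_scaled_derivn_pchar]). Truncating the geometric series of the factors of
[1 / f] at order [p] gives such a [v], as [f v] is a product of factors
[1 - (- x_s z)^p]. The coefficient of [x^J] in [v_(p-1)] is
[(-1)^(p-1) = 1] in [F_p] for every [J] of sum [p - 1]. *)

Set Implicit Arguments.
Unset Strict Implicit.
Unset Printing Implicit Defensive.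

(** * The recursion on multisets of parts *)

(** The recursion of [d_rec] with one summand for each part instead of one for
each corner. Its value is invariant under permuting the parts and inserting zeros,
so a decreased part may simply be put back at the head of the list. *)
Fixpoint d_parts (N : nat) (L : seq nat) : nat :=
  if N is N'.+1 then
    \sum_(x <- L | 0 < x) (N - x + 1) * d_parts N' (x.-1 :: rem x L)
  else 1.

Lemma d_parts_perm N L M : perm_eq L M -> d_parts N L = d_parts N M.
Proof.
elim: N L M => [//|N IHN] L M LM /=; rewrite (perm_big _ LM) /=.
rewrite big_seq_cond [RHS]big_seq_cond; apply: eq_bigr => x /andP[Mx _].
congr (_ * _); apply: IHN; apply/permP => P.
by rewrite /= !count_rem (permP LM) (perm_mem LM).
Qed.

Lemma d_parts0 N L : d_parts N (0 :: L) = d_parts N L.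
Proof.
elim: N L => [//|N IHN] L /=; rewrite big_cons /=.
apply: eq_bigr => -[//|x] _ /=.
congr (_ * _); rewrite -[RHS]IHN.
by apply: d_parts_perm; apply/permP => P /=; lia.
Qed.

Lemma d_parts_filter N L : d_parts N [seq x <- L | 0 < x] = d_parts N L.
Proof.
have nz k : d_parts N (nseq k 0 ++ [seq x <- L | 0 < x])
          = d_parts N [seq x <- L | 0 < x].
  by elim: k => //= k IHk; rewrite d_parts0.
(* Putting as many zeros in front as were dropped gives a permutation of L. *)
rewrite -(nz (count_mem 0 L)); apply: d_parts_perm; apply/permP => P.
rewrite count_cat count_nseq.
elim: L {nz} => [|[|x] L IHL] /=; first by rewrite muln0.
  by move: IHL; case: (P 0) => /=; lia.
by rewrite add0n addnCA IHL.
Qed.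

Lemma perm_set_nth (L : seq nat) s y :
  s < size L -> perm_eq (set_nth 0 L s y) (y :: rem (nth 0 L s) L).
Proof.
move=> lt_s; apply/permP => P /=; rewrite count_rem mem_nth //=.
elim: L s lt_s => // x L IHL [|s] /= lt_s; first by lia.
have := IHL s lt_s; have: nth 0 L s \in L by rewrite mem_nth.
move=> sL; have: P (nth 0 L s) -> 0 < count P L.
  by move=> Ps; rewrite -has_count; apply/hasP; exists (nth 0 L s).
by case: (P _) => [/(_ isT)|_] /=; lia.
Qed.

Lemma young_remove_box J s :
  young_diagram J -> part J s.+1 < part J s -> young_diagram (remove_box J s).
Proof.
rewrite /young_diagram /remove_box /part => /andP[sJ _] lt_s.
rewrite filter_all andbT.
apply: sorted_filter; first exact: (rev_trans leq_trans).
apply/(sortedP 0) => i _; rewrite !nth_set_nth /= /geq /=.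
have le_nth k : nth 0 J k.+1 <= nth 0 J k.
  case: (ltnP k.+1 (size J)) => [|k_ge]; last by rewrite nth_default.
  by move/(sortedP 0): sJ; apply.
have := le_nth i; have := le_nth i.+1.
case: (eqVneq i.+1 s) => [Es|_]; case: (eqVneq i s) => [E|_] //; subst; lia.
Qed.

(** In a weakly decreasing sequence the corners are the last occurrences of
the part sizes, and [undup] keeps exactly the last occurrences. *)
Lemma sum_corners (J : seq nat) (G : nat -> nat) : young_diagram J ->
  \sum_(s < size J | part J s.+1 < part J s) G (part J s)
  = \sum_(x <- undup J) G x.
Proof.
elim: J => [|x J IHJ]; first by rewrite big_ord0 big_nil.
rewrite /young_diagram /= => /andP[pxJ /andP[x_gt0 pJ]].
rewrite big_mkcond big_ord_recl -big_mkcond /= IHJ; last first.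
  by rewrite /young_diagram pJ (path_sorted pxJ).
suff ->: (part (x :: J) 1 < part (x :: J) 0) = (x \notin J).
  by case: (x \in J); rewrite ?big_cons.
rewrite /part /=; case: J pxJ {IHJ pJ} => [|y J] /=; first by rewrite x_gt0.
move=> /andP[xy pyJ]; rewrite inE negb_or /geq /= in xy *.
have yJ: all (geq y) J.
  by apply: order_path_min pyJ; exact: (rev_trans leq_trans).
rewrite ltn_neqAle xy andbT eq_sym; case: eqP => //= nxy.
by apply/esym/negP => /(allP yJ) /=; rewrite /geq /=; lia.
Qed.

(** The multiplicity [n_k] in the recursion for [d] counts the parts of size
[k], each of which contributes the same summand to [d_parts]. *)
Lemma d_parts_d_rec N J : young_diagram J -> d_rec N J = d_parts N J.
Proof.
elim: N J => [//|N IHN] J yJ.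
have [_ pJ] := andP yJ.
rewrite [LHS]/= [RHS]/=.
transitivity
  (\sum_(x <- J) (N.+1 - x + 1) * d_parts N (x.-1 :: rem x J)); last first.
  rewrite big_seq_cond [RHS]big_seq_cond; apply: eq_bigl => x.
  by case: (boolP (x \in J)) => //= /(allP pJ) /= ->.
rewrite -[RHS]big_undup_iterop_count.
rewrite -(sum_corners (fun x => iterop (count_mem x J) addn _ 0)) //.
apply: eq_bigr => s s_corner; rewrite Monoid.iteropE iter_addn_0.
rewrite IHN ?young_remove_box // mulnAC /remove_box d_parts_filter.
by congr (_ * _ * _); apply: d_parts_perm; rewrite perm_set_nth.
Qed.

(** * Weighted words *)

Fixpoint words (m n : nat) : seq (seq 'I_m) :=
  if n is n'.+1 then [seq s :: w | s <- enum 'I_m, w <- words m n']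
  else [:: [::]].

(** Words grow at the head. The weight is the number of ways to attach each
letter either to a root or to an earlier letter different from it. *)
Fixpoint attachments (m : nat) (w : seq 'I_m) : nat :=
  if w is s :: w' then (size w' - count_mem s w').+1 * attachments w' else 1.

Definition content (m : nat) (w : seq 'I_m) : 'X_{1..m} :=
  [multinom count_mem s w | s < m].

Lemma size_words m n w : w \in words m n -> size w = n.
Proof.
elim: n w => [|n IHn] w /=; first by rewrite inE => /eqP ->.
by case/allpairsP=> -[s v] /= [_ /IHn <- ->].
Qed.

Lemma content_cons m (s : 'I_m) w : content (s :: w) = (U_(s) + content w)%MM.
Proof. by apply/mnmP => r; rewrite mnmDE !mnmE. Qed.

(** Deleting the last letter [s] added to a word of content [L] leaves a word
of content [L - U_(s)], and its factor is the weight [N - L s + 1] of the part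
[L s] in the recursion. *)
Lemma sum_attachments m N (L : 'X_{1..m}) : mdeg L = N ->
  \sum_(w <- words m N | content w == L) attachments w = d_parts N L.
Proof.
elim: N L => [|N IHN] L degL.
  rewrite /= big_cons big_nil; move/eqP: degL; rewrite mdeg_eq0 => /eqP ->.
  by rewrite ifT //; apply/eqP/mnmP => s; rewrite !mnmE.
rewrite /= big_mkcond big_allpairs_dep big_enum big_tuple [RHS]big_mkcond /=.
apply: eq_bigr => s _; rewrite -[tnth L s]/(L s); rewrite -big_mkcond /=.
under eq_bigl do rewrite content_cons.
case: ifPn => [Ls_gt0|]; last first.
  rewrite -eqn0Ngt => /eqP Ls0; apply: big1 => w /eqP E.
  by move: Ls0; rewrite -E mnmDE mnm1E eqxx.
have UL : (U_(s) <= L)%MM by rewrite lep1mP -lt0n.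
transitivity (\sum_(w <- words m N | content w == (L - U_(s))%MM)
                (N.+1 - L s + 1) * attachments w).
  rewrite big_seq_cond [RHS]big_seq_cond; apply: eq_big => [w|w].
    congr (_ && _); apply/eqP/eqP => [<-|->]; first by rewrite addmC addmK.
    by rewrite addmC submK.
  case/andP=> /size_words -> /eqP E; congr (_ * _).
  have := congr1 (fun M : 'X_{1..m} => M s) E.
  by rewrite mnmDE mnm1E eqxx [content w s]mnmE => <-; rewrite subSS addn1.
rewrite -big_distrr /= IHN; last first.
  apply/eqP; rewrite -(eqn_add2r (mdeg U_(s)%MM)).
  by rewrite -mdegD submK // mdeg1 degL addn1.
congr (_ * _); apply: d_parts_perm.
have -> : multinom_val (L - U_(s))%MM = set_nth 0 L s (L s).-1 :> seq nat.
  apply: (@eq_from_nth _ 0).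
    by rewrite size_set_nth !size_tuple; apply/esym/maxn_idPr.
  move=> i; rewrite size_tuple => lt_i.
  have nthE (M : 'X_{1..m}) : nth 0 M i = M (Ordinal lt_i).
    by rewrite (mnm_nth 0).
  rewrite nthE mnmBE mnm1E nth_set_nth /= nthE -val_eqE /= eq_sym.
  case: eqP => [E|_]; last by rewrite subn0.
  by rewrite (_ : Ordinal lt_i = s) ?subn1 //; apply: val_inj.
by rewrite (perm_trans (perm_set_nth _ _)) ?size_tuple // (mnm_nth 0).
Qed.

(** * Iterates of the derivation f d/dz *)

Import GRing.Theory.
Local Open Scope ring_scope.

Definition scaled_deriv (R : comNzRingType) (f g : {poly R}) := f * g^`().

Lemma scaled_deriv_is_linear (R : comNzRingType) (f : {poly R}) :
  linear (scaled_deriv f).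
Proof.
by move=> c g h; rewrite /scaled_deriv derivD derivZ mulrDr scalerAr.
Qed.

HB.instance Definition _ (R : comNzRingType) (f : {poly R}) :=
  GRing.isLinear.Build R {poly R} {poly R} *:%R (scaled_deriv f)
    (scaled_deriv_is_linear f).

Definition scaled_derivn (R : comNzRingType) (f : {poly R}) n g :=
  iter n (scaled_deriv f) g.

Lemma scaled_derivn_is_linear (R : comNzRingType) (f : {poly R}) n :
  linear (scaled_derivn f n).
Proof.
by move=> c g h; rewrite /scaled_derivn; elim: n => //= n ->; rewrite linearP.
Qed.

HB.instance Definition _ (R : comNzRingType) (f : {poly R}) n :=
  GRing.isLinear.Build R {poly R} {poly R} *:%R (scaled_derivn f n)
    (scaled_derivn_is_linear f n).

Lemma scaled_derivnS (R : comNzRingType) (f g : {poly R}) n :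
  scaled_derivn f n.+1 g = scaled_deriv f (scaled_derivn f n g).
Proof. by []. Qed.

Lemma scaled_derivnSr (R : comNzRingType) (f g : {poly R}) n :
  scaled_derivn f n.+1 g = scaled_derivn f n (scaled_deriv f g).
Proof. exact: iterSr. Qed.

Lemma scaled_derivnM (R : comNzRingType) (f g h : {poly R}) n :
  scaled_derivn f n (g * h)
  = \sum_(i < n.+1)
      (scaled_derivn f (n - i) g * scaled_derivn f i h) *+ 'C(n, i).
Proof.
elim: n => [|n IHn].
  by rewrite big_ord_recl big_ord0 addr0.
rewrite scaled_derivnS IHn raddf_sum /=.
under eq_bigr => i _.
  rewrite raddfMn /= {1}/scaled_deriv derivM mulrDr mulrA mulrCA.
  rewrite -/(scaled_deriv f _) -/(scaled_deriv f (scaled_derivn f i h)).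
  rewrite -!scaled_derivnS -subSn; last by rewrite -ltnS.
  rewrite mulrnDl.
  over.
rewrite big_split /= [RHS]big_ord_recl.
under [in RHS]eq_bigr => i _ do rewrite lift0 binS mulrnDr subSS.
rewrite big_split /= addrA; congr (_ + _).
rewrite [LHS]big_ord_recl !bin0; congr (_ + _).
by rewrite [RHS]big_ord_recr /= bin_small // mulr0n addr0.
Qed.

(** In the Leibniz formula for the [p]-th iterate, the binomials
['C(p, i)] with [0 < i < p] are divisible by [p]. *)
Lemma scaled_derivn_pcharM (R : comNzRingType) p (f g h : {poly R}) :
  p \in [pchar R] ->
  scaled_derivn f p (g * h) = scaled_derivn f p g * h + g * scaled_derivn f p h.
Proof.
move=> charRp; have p_pr := pcharf_prime charRp.
case: p charRp p_pr => // p charRp p_pr.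
rewrite scaled_derivnM big_ord_recl big_ord_recr lift0 binn bin0 subnn subn0.
rewrite big1 => [|i _]; first by rewrite /= add0r.
rewrite lift0 /=.
have /dvdnP[k ->] : (p.+1 %| 'C(p.+1, (widen_ord (leqnSn p) i).+1))%N.
  by apply: prime_dvd_bin => //=; rewrite ltnS ltn_ord.
by rewrite mulrnA -mulr_natr -polyC_natr (pcharf0 charRp) polyC0 mulr0.
Qed.

Lemma coef0_scaled_derivn_Xn (R : comNzRingType) (f g : {poly R}) n :
  (scaled_derivn f n ('X^n * g))`_0 = f`_0 ^+ n * g`_0 *+ n`!.
Proof.
elim: n g => [|n IHn] g; first by rewrite !expr0 !mul1r.
rewrite scaled_derivnSr.
have -> : scaled_deriv f ('X^(n.+1) * g)
        = 'X^n * (f * g *+ n.+1 + 'X * f * g^`()).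
  by rewrite /scaled_deriv derivM derivXn exprS /=; ring.
rewrite IHn coefD coefMn -mulrA coefXM addr0 coef0M exprSr.
by rewrite mulrnAr -mulrnA mulrA factS.
Qed.

(** Up to the nonzero factor [k.+1] this is the constant coefficient of the
[p]-th iterate at ['X^(k.+1)]; a derivation maps this product of two polynomials
vanishing at 0 to one that vanishes at 0. *)
Lemma coef0_scaled_derivn_mulXn (R : idomainType) p (f : {poly R}) k :
  p \in [pchar R] ->
  (0 < k < p.-1)%N -> (scaled_derivn f p.-1 (f * 'X^k))`_0 = 0.
Proof.
move=> charRp /andP[k_gt0 k_lt]; have p_pr := pcharf_prime charRp.
have k1_neq0 : k.+1%:R != 0 :> R.
  rewrite -(dvdn_pcharf charRp); apply/negP => /dvdn_leq; lia.
apply: (mulfI k1_neq0); rewrite mulr0 mulr_natl -coefMn -raddfMn /=.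
have -> : f * 'X^k *+ k.+1 = scaled_deriv f ('X^k * 'X).
  by rewrite /scaled_deriv -exprSr derivXn mulrnAr.
rewrite -scaled_derivnSr prednK ?prime_gt0 //.
rewrite (scaled_derivn_pcharM _ _ _ charRp).
case: k k_gt0 {k_lt k1_neq0} => // k _; rewrite coefD coefMX add0r.
by rewrite exprS -mulrA coefXM.
Qed.

Lemma wilson_pchar (R : comNzRingType) p :
  p \in [pchar R] -> (p.-1)`!%:R = -1 :> R.
Proof.
move=> charRp; have p_pr := pcharf_prime charRp.
have := Wilson (prime_gt1 p_pr); rewrite p_pr => /esym.
rewrite (dvdn_pcharf charRp) -addn1 natrD => /eqP E.
by apply/eqP; rewrite -addr_eq0 E.
Qed.

(** The iterate of order [p.-1] kills [f * v]. Expanding [v] in powers of ['X],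
only the powers 0 and [p.-1] contribute to the constant coefficient, and the
latter contributes [(p.-1)`! = -1] times [v`_p.-1]. *)
Lemma coef0_scaled_derivn_pchar (R : idomainType) p (f v : {poly R}) :
  p \in [pchar R] -> f`_0 = 1 -> v`_0 = 1 -> (f * v)^`() = 0 ->
  (scaled_derivn f p.-1 f)`_0 = v`_p.-1.
Proof.
move=> charRp f0 v0 fv'; have p_pr := pcharf_prime charRp.
have p1_gt0 : (0 < p.-1)%N by case: p p_pr {charRp} => [|[|p]].
(* The bound p in the expansion of v makes the power p.-1 occur in it even
   when v has small degree. *)
pose k := maxn (size v) p.
have k_gt : (p.-1 < k)%N by rewrite /k leq_max; apply/orP; right; lia.
have vE : v = \sum_(i < k) v`_i *: 'X^i.
  rewrite -poly_def; apply/polyP => i; rewrite coef_poly.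
  by case: ltnP => // /(leq_trans (leq_maxl _ _)); apply: nth_default.
have : (scaled_derivn f p.-1 (f * v))`_0 = 0.
  rewrite -(prednK p1_gt0) scaled_derivnSr /scaled_deriv fv' mulr0.
  by rewrite raddf0 coef0.
rewrite {1}vE mulr_sumr raddf_sum coef_sum /=.
rewrite (eq_bigr
  (fun i : 'I_k => v`_i * (scaled_derivn f p.-1 (f * 'X^i))`_0)); last first.
  by move=> i _; rewrite -scalerAr linearZ_LR coefZ.
rewrite (bigD1 (Ordinal (leq_ltn_trans (leq0n _) k_gt))) //=.
rewrite (bigD1 (Ordinal k_gt)) /=; last by rewrite -val_eqE /= -lt0n.
rewrite big1 ?addr0 => [|i /andP[]]; last first.
  rewrite -!val_eqE /= -lt0n => i_gt0 i_neq.
  have [i_lt|i_gt|i_eq] := ltngtP i p.-1; last by rewrite i_eq eqxx in i_neq.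
    by rewrite coef0_scaled_derivn_mulXn ?mulr0 // i_gt0.
  rewrite mulrC -(subnKC i_gt) exprD exprSr -!mulrA [f * _]mulrC -!mulrA.
  by rewrite coef0_scaled_derivn_Xn coefXM mulr0 mul0rn mul0r.
rewrite expr0 mulr1 v0 mul1r [f * _]mulrC coef0_scaled_derivn_Xn.
rewrite f0 expr1n mul1r.
by rewrite wilson_pchar // mulrN1 => /eqP; rewrite subr_eq0 => /eqP.
Qed.

(** * Words and products of linear factors *)

Lemma deriv_prod (R : comNzRingType) (I : finType) (g : I -> {poly R}) :
  (\prod_i g i)^`() = \sum_i (g i)^`() * \prod_(j | j != i) g j.
Proof.
have := index_enum_uniq I; elim: (index_enum I) => [|i r IHr] /=.
  by rewrite !big_nil derivC.
case/andP=> ir ur; rewrite !big_cons derivM IHr // eqxx /=; congr (_ + _).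
  congr (_ * _); rewrite big_seq [RHS]big_seq_cond; apply: eq_bigl => j.
  case: (boolP (j \in r)) => //= jr.
  by apply/esym/negP => /eqP E; rewrite -E jr in ir.
rewrite mulr_sumr big_seq [RHS]big_seq; apply: eq_bigr => j jr.
rewrite big_cons ifT; first by rewrite mulrCA.
by apply/eqP => E; rewrite E jr in ir.
Qed.

Definition lin_factor (R : comNzRingType) m (x : 'I_m -> R) s : {poly R} :=
  1 + x s *: 'X.

Lemma coef0_lin_factor (R : comNzRingType) m (x : 'I_m -> R) s :
  (lin_factor x s)`_0 = 1.
Proof. by rewrite coefD coef1 coefZ coefX mulr0 addr0. Qed.

Lemma deriv_lin_factor (R : comNzRingType) m (x : 'I_m -> R) s :
  (lin_factor x s)^`() = (x s)%:P.
Proof.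
by rewrite /lin_factor derivD derivZ derivX -polyC1 derivC add0r alg_polyC.
Qed.

Definition word_term (R : comNzRingType) m (x : 'I_m -> R) (w : seq 'I_m) :
    {poly R} :=
  (\prod_(s <- w) x s)
  *: \prod_r lin_factor x r ^+ ((size w).+1 - count_mem r w).

(** Differentiating the factor of [s] brings down its exponent, which is the
weight of a new letter [s], and [x s]; multiplying by all the linear factors
raises by one the exponents of the letters other than [s]. *)
Lemma scaled_deriv_word_term (R : comNzRingType) m (x : 'I_m -> R)
    (w : seq 'I_m) :
  scaled_deriv (\prod_s lin_factor x s) (word_term x w)
  = \sum_s word_term x (s :: w) *+ (size w - count_mem s w).+1.
Proof.
rewrite /word_term linearZZ /= /scaled_deriv deriv_prod mulr_sumr scaler_sumr.
apply: eq_bigr => s _.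
rewrite big_cons [x s * _]mulrC -scalerA scalerMnr; congr (_ *: _).
have count_le r : (count_mem r w <= size w)%N by apply: count_size.
rewrite (bigD1 s) //= [in RHS](bigD1 s) //= eqxx.
have -> :
    \prod_(r | r != s)
      lin_factor x r ^+ ((size w).+2 - ((s == r) + count_mem r w))
  = \prod_(r | r != s) lin_factor x r
    * \prod_(r | r != s) lin_factor x r ^+ ((size w).+1 - count_mem r w).
  rewrite -big_split /=; apply: eq_bigr => r rs.
  rewrite eq_sym (negPf rs) add0n -exprS.
  by rewrite subSn // ltnW // ltnS.
rewrite deriv_exp deriv_lin_factor add1n !subSS !subSn //=.
by rewrite -mul_polyC exprS /=; ring.
Qed.

Lemma scaled_derivn_words (R : comNzRingType) m (x : 'I_m -> R) n
    (f := \prod_s lin_factor x s) :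
  scaled_derivn f n f = \sum_(w <- words m n) word_term x w *+ attachments w.
Proof.
elim: n => [|n IHn].
  rewrite /= big_cons big_nil addr0 mulr1n /word_term big_nil scale1r /=.
  by apply: eq_bigr => r _; rewrite subn0 expr1.
rewrite scaled_derivnS IHn raddf_sum /=.
rewrite big_allpairs_dep big_enum exchange_big /=.
apply: eq_bigr => w _; rewrite raddfMn /= scaled_deriv_word_term -sumrMnl.
by apply: eq_bigr => s _; rewrite -mulrnA.
Qed.

Lemma mpolyX_content (R : comNzRingType) m (w : seq 'I_m) :
  \prod_(s <- w) 'X_s = 'X_[content w] :> {mpoly R[m]}.
Proof.
elim: w => [|s w IHw].
  have -> : content [::] = 0%MM :> 'X_{1..m} by apply/mnmP => s; rewrite !mnmE.
  by rewrite big_nil mpolyX0.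
by rewrite big_cons IHw content_cons mpolyXD.
Qed.

(** At 0 all the linear factors are 1, so a word term reduces to the monomial
of its content. *)
Lemma mcoeff_scaled_derivn (R : comNzRingType) m n (L : 'X_{1..m})
    (f := \prod_s lin_factor (fun s => 'X_s : {mpoly R[m]}) s) :
  mdeg L = n ->
  ((scaled_derivn f n f)`_0)@_L = (d_parts n L)%:R.
Proof.
move=> degL; rewrite scaled_derivn_words coef_sum raddf_sum /=.
rewrite -(sum_attachments degL).
rewrite natr_sum [RHS]big_mkcond /=; apply: eq_bigr => w _.
rewrite coefMn mcoeffMn /word_term coefZ mpolyX_content coef0_prod big1 ?mulr1.
  by rewrite mcoeffX; case: (_ == _); rewrite ?mul0rn.
move=> r _.
by rewrite -horner_coef0 horner_exp horner_coef0 coef0_lin_factor expr1n.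
Qed.

(** * The truncated inverse of the product of linear factors *)

(** Each factor is the geometric series of the inverse of [lin_factor x s], cut
off before the [p]-th power. *)
Definition geometric_prod (R : comNzRingType) m (x : 'I_m -> R) p : {poly R} :=
  \prod_s \sum_(k < p) (- (x s *: 'X)) ^+ k.

Lemma coef0_geometric_prod (R : comNzRingType) m (x : 'I_m -> R) p :
  (0 < p)%N -> (geometric_prod x p)`_0 = 1.
Proof.
case: p => // p _; rewrite coef0_prod big1 // => s _.
rewrite big_ord_recl expr0 coefD coef1 coef_sum big1 ?addr0 // => k _.
rewrite lift0 -horner_coef0 horner_exp hornerN hornerZ hornerX.
by rewrite mulr0 oppr0 expr0n.
Qed.

(** The product telescopes to factors [1 - (- (x s *: 'X)) ^+ p], and [p]-th
powers have zero derivative. *)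
Lemma deriv_geometric_prod (R : comNzRingType) m (x : 'I_m -> R) p :
  p \in [pchar R] -> ((\prod_s lin_factor x s) * geometric_prod x p)^`() = 0.
Proof.
move=> charRp; rewrite -big_split deriv_prod big1 // => s _ /=.
rewrite [X in X^`()](_ : _ = 1 - (- (x s *: 'X)) ^+ p); last first.
  by rewrite -opprB subrX1 -mulNr opprB opprK.
rewrite derivB -polyC1 derivC deriv_exp -mulr_natr -polyC_natr.
by rewrite (pcharf0 charRp) mulr0 subr0 mul0r.
Qed.

(** In the expanded product only the choice of the power [L s] from the factor
of each [s] gives the monomial [L], and the power of ['X] that comes with it is
the degree of [L]. *)
Lemma mcoeff_geometric_prod (R : comNzRingType) m p n (L : 'X_{1..m}) :
  mdeg L = n -> (n < p)%N ->
  ((geometric_prod (fun s => 'X_s : {mpoly R[m]}) p)`_n)@_L = (-1) ^+ n.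
Proof.
move=> degL n_lt; rewrite /geometric_prod bigA_distr_bigA /=.
pose expo (phi : {ffun 'I_m -> 'I_p}) := [multinom (phi s : nat) | s < m].
have L_lt s : (L s < p)%N.
  by apply: leq_ltn_trans n_lt; rewrite -degL mdegE (bigD1 s) //= leq_addr.
have termE (phi : {ffun 'I_m -> 'I_p}) :
    \prod_s (- ('X_s *: 'X)) ^+ phi s
  = ((-1) ^+ mdeg (expo phi) * 'X_[expo phi]) *: 'X^(mdeg (expo phi))
    :> {poly {mpoly R[m]}}.
  rewrite mpolyXE_id mdegE -!prodrXr -big_split /= -scaler_prod.
  apply: eq_bigr => s _.
  by rewrite mnmE -scaleNr exprZn -exprNn.
have coefE (phi : {ffun 'I_m -> 'I_p}) :
    ((\prod_s (- ('X_s *: 'X)) ^+ phi s)`_n)@_L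
  = (-1) ^+ n * (expo phi == L)%:R :> R.
  rewrite termE coefZ coefXn mulr_natr mcoeffMn -signr_odd.
  rewrite -[(-1) ^+ n]signr_odd mulr_sign [RHS]mulr_sign.
  case: (eqVneq (expo phi) L) => [->|neq].
    by rewrite degL eqxx mulr1n; case: odd; rewrite ?mcoeffN mcoeffX eqxx.
  by case: odd; case: odd; rewrite ?mcoeffN mcoeffX (negPf neq) ?oppr0 mul0rn.
pose phi0 := [ffun s => Ordinal (L_lt s)].
rewrite coef_sum raddf_sum (eq_bigr _ (fun phi _ => coefE phi)) /= -mulr_sumr.
rewrite (bigD1 phi0) //= [X in _ + X]big1 => [|phi phi_neq].
  rewrite (_ : expo phi0 = L) ?eqxx ?addr0 ?mulr1 //.
  by apply/mnmP => s; rewrite !mnmE ffunE.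
case: eqP => // E; case/eqP: phi_neq; apply/ffunP => s; rewrite ffunE.
by apply: val_inj; rewrite /= -E mnmE.
Qed.

(** * The congruence *)

Lemma d_parts_mod p L :
  prime p -> sumn L = p.-1 -> (d_parts p.-1 L = 1 %[mod p])%N.
Proof.
move=> p_pr sL; pose M := Multinom (in_tuple L).
have degM : mdeg M = p.-1 by rewrite -sL sumnE.
have charp := pchar_Fp p_pr.
have charmp : p \in [pchar {mpoly 'F_p[size L]}].
  exact: (rmorph_pchar (@mpolyC (size L) 'F_p)).
pose x s : {mpoly 'F_p[size L]} := 'X_s.
have f0 : (\prod_s lin_factor x s)`_0 = 1.
  by rewrite coef0_prod big1 // => s _; apply: coef0_lin_factor.
have v0 := coef0_geometric_prod x (prime_gt0 p_pr).
have := coef0_scaled_derivn_pchar charmp f0 v0 (deriv_geometric_prod x charmp).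
move/(congr1 (mcoeff M)); rewrite mcoeff_scaled_derivn //.
rewrite mcoeff_geometric_prod ?prednK ?prime_gt0 //.
(* The Frobenius map fixes -1, also for p = 2. *)
have -> : (-1) ^+ p.-1 = 1 :> 'F_p.
  apply: oppr_inj; rewrite -[LHS]mulN1r -exprS prednK ?prime_gt0 //.
  by rewrite -pFrobenius_autE pFrobenius_autN pFrobenius_aut1.
rewrite -[1 in RHS]/(1%:R) => /(congr1 (@nat_of_ord _)).
by rewrite !val_Fp_nat.
Qed.

Local Close Scope ring_scope.

Theorem theorem4 (p : nat) (J : seq nat) :
  prime p -> young_diagram J -> sumn J = p.-1 -> d J = 1 %[mod p].
Proof.
by move=> p_pr yJ sJ; rewrite /d d_parts_d_rec // sJ; apply: d_parts_mod.
Qed.
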